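(* Let $\mathcal{P}$ be a random walk program that is positively almost surely terminating, let $\lambda_1,\dots,\lambda_c$ be the pairwise distinct complex roots of its characteristic polynomial $\chi_{\mathcal{P}}(\lambda)=\sum_{-k\le j\le m}p_j\lambda^{k+j}-\lambda^k$ with multiplicities $v_1,\dots,v_c$, and let $C(x)=\frac1{p'}$ if $p'>0$ and $C(x)=-\frac{1}{\mu_{\mathcal{P}}}\cdot x$ if $p'=0$, where $\mu_{\mathcal{P}}=\sum_{-k\le j\le m}j\,p_j$. Then the expected runtime of $\mathcal{P}$ is $rt^{\mathcal{P}}_x=0$ for $x\le0$ and $$rt^{\mathcal{P}}_x=C(x)+\sum_{1\le j\le c,\ |\lambda_j|\le1}\ \sum_{0\le u\le v_j-1}a_{j,u}\,\lambda_j^x\,x^u\quad\text{for }x>0,$$ where the coefficients $a_{j,u}$ are the unique solution of the $k$ linear equations $$0=C(x)+\sum_{1\le j\le c,\ |\lambda_j|\le1}\ \sum_{0\le u\le v_j-1}a_{j,u}\,\lambda_j^x\,x^u\quad\text{for }-k+1\le x\le0.$$ In particular, if $k=0$, then $rt^{\mathcal{P}}_x=\frac{1}{p'}$ for $x>0$.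
   Context: A random walk program is a one-variable program: while $(x>0)$ do: $x:=x+j$ with probability $p_j$ for each $-k\le j\le m$; $x:=d$ with probability $p'$; where $m,k\in\mathbb{N}$, $d\in\mathbb{Z}$, $d\le0$, the $p_j,p'\ge0$ are constants summing to 1, and $m>0$ implies $p_m>0$, $k>0$ implies $p_{-k}>0$. Semantics: Markov chain on $\mathbb{Z}$ started at $x$ moving from $z>0$ to $z+j$ w.p. $p_j$ and to $d$ w.p. $p'$, and staying put at $z\le0$; $T$ is the first index of a run with value $\le0$; the expected runtime $rt^{\mathcal{P}}_x$ is $\mathbb{E}_x(T)$ if $\mathbb{P}_x(T<\infty)=1$ and $\infty$ otherwise; positively almost surely terminating means $rt^{\mathcal{P}}_x<\infty$ for every $x\in\mathbb{Z}$. *)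

(* Defs.v *)
From HB Require Import structures.
From mathcomp Require Import all_boot all_order all_algebra.
From mathcomp Require Import complex.
From mathcomp Require Import all_classical all_reals all_analysis.
From mathcomp Require Import measurable_realfun ring lra.

Set Implicit Arguments.
Unset Strict Implicit.
Unset Printing Implicit Defensive.

Import Order.TTheory GRing.Theory Num.Theory.
Import numFieldNormedType.Exports.

Local Open Scope classical_set_scope.
Local Open Scope ring_scope.
Local Open Scope complex_scope.

(* Only the values [rw_p P j] for [- rw_k <= j <= rw_m] are meaningful; the
   index [i < (rw_k + rw_m).+1] of the sums below stands for [j = i - rw_k]. *)
Record rw_program (R : realType) := RwProgram {
  rw_m : nat;
  rw_k : nat;
  rw_d : int;
  rw_p : int -> R;
  rw_p' : R;
  rw_d_le0 : rw_d <= 0;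
  rw_p_ge0 : forall j : int, - rw_k%:Z <= j <= rw_m%:Z -> 0 <= rw_p j;
  rw_p'_ge0 : 0 <= rw_p';
  rw_sum1 : \sum_(i < (rw_k + rw_m).+1) rw_p (i%:Z - rw_k%:Z) + rw_p' = 1;
  rw_pm_gt0 : (0 < rw_m)%N -> 0 < rw_p rw_m%:Z;
  rw_pk_gt0 : (0 < rw_k)%N -> 0 < rw_p (- rw_k%:Z)
}.

HB.instance Definition _ := isPointed.Build int 0.

Definition cylinder (n : nat) (s : nat -> int) : set (nat -> int) :=
  [set w | forall i, (i <= n)%N -> w i = s i].

Definition cylinders : set (set (nat -> int)) :=
  [set C | exists n s, C = cylinder n s].

Definition run := g_sigma_algebraType cylinders.

Section semantics.
Context {R : realType} (P : rw_program R).

Definition rw_trans (z z' : int) : R :=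
  if 0 < z then
    \sum_(i < (rw_k P + rw_m P).+1)
       (if z' == z + (i%:Z - (rw_k P)%:Z) then rw_p P (i%:Z - (rw_k P)%:Z) else 0)
    + (if z' == rw_d P then rw_p' P else 0)
  else if z' == z then 1 else 0.

Definition is_run_measure (x : int) (Q : probability run R) : Prop :=
  forall (n : nat) (s : nat -> int),
    Q (cylinder n s) =
    (if s 0%N == x then \prod_(i < n) rw_trans (s i) (s i.+1) else 0)%:E.

End semantics.

(* Existence of the run measure: a point [v] of [0, 1[ with Lebesgue measure is
   decoded into a run by repeatedly splitting the unit interval into pieces
   whose lengths are the probabilities of the branches of the program. *)
Lemma lebesgue_measure_affine (R : realType) (c q : R) (A : set R) :
  0 < q -> measurable A ->
  lebesgue_measure ((fun v => (v - c) / q) @^-1` A) =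
    (q%:E * lebesgue_measure A)%E.
Proof.
move=> q0 mA.
pose f : measurableTypeR R -> measurableTypeR R := fun v => (v - c) / q.
have mf : measurable_fun [set: measurableTypeR R] f.
  by apply: measurable_funM => //; exact: measurable_funB.
have q10 : 0 <= q^-1 by rewrite invr_ge0 ltW.
pose nu : {measure set (measurableTypeR R) -> \bar R} :=
  mscale (NngNum q10) (measure_function_pushforward__canonical__measure_function_Measure
    lebesgue_measure mf).
rewrite (@lebesgue_measure_unique R nu _ A mA).
  by rewrite /nu /= /mscale /= /pushforward muleA -EFinM mulfV ?mul1e// gt_eqF.
move=> _ [[a b] _ <-] /=.
rewrite /nu /= /mscale /= /pushforward.
rewrite (_ : _ @^-1` _ = `]c + q * a, c + q * b]%classic); last first.
  apply/seteqP; split => v /=;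
    rewrite !in_itv/= /f ltr_pdivlMr// ler_pdivrMr// => /andP[h1 h2];
    apply/andP; split; lra.
rewrite !lebesgue_measure_itv/= !lte_fin ltrD2l ltr_pM2l//.
case: ifP => _; last by rewrite mule0.
by rewrite -!EFinD -EFinM; congr (_%:E); field; rewrite gt_eqF.
Qed.

Section run_measure_existence.
Context {R : realType} (P : rw_program R).
Local Notation mu := (@lebesgue_measure R).
Local Notation N := (rw_k P + rw_m P).+2.

Let weight (i : nat) : R :=
  if (i < (rw_k P + rw_m P).+1)%N then rw_p P (i%:Z - (rw_k P)%:Z) else rw_p' P.

Let target (z : int) (i : nat) : int :=
  if 0 < z then
    (if (i < (rw_k P + rw_m P).+1)%N then z + (i%:Z - (rw_k P)%:Z) else rw_d P)
  else z.

Let cumul (n : nat) : R := \sum_(i < n) weight i.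

Let branch (v : R) : nat := find (fun i => v < cumul i.+1) (iota 0 N).

Let decode1 (zv : int * R) : int * R :=
  let i := branch zv.2 in (target zv.1 i, (zv.2 - cumul i) / weight i).

Let decode (z : int) (v : R) (n : nat) : int := (iter n decode1 (z, v)).1.

Let weight_ge0 i : (i < N)%N -> 0 <= weight i.
Proof.
move=> _; rewrite /weight; case: ltnP => [iN|_]; last exact: rw_p'_ge0.
apply: rw_p_ge0; move: iN => /=; rewrite ltnS => iN.
by rewrite lerBrDr addNr lez_nat leq0n /= lerBlDr -PoszD lez_nat addnC.
Qed.

Let cumulS n : cumul n.+1 = cumul n + weight n.
Proof. by rewrite /cumul big_ord_recr. Qed.

Let cumul_le i j : (i <= j)%N -> (j <= N)%N -> cumul i <= cumul j.
Proof.
move=> ij jN; rewrite -(subnKC ij) in jN *.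
elim: (j - i)%N jN => [|n IHn] jN; first by rewrite addn0.
rewrite addnS in jN *.
by rewrite cumulS (le_trans (IHn (ltnW jN)))// lerDl weight_ge0.
Qed.

Let cumulN : cumul N = 1.
Proof.
rewrite cumulS -[RHS](rw_sum1 P) /cumul /weight ltnn; congr (_ + _).
by apply: eq_bigr => i _; rewrite ltn_ord.
Qed.

Let trans_target z z' :
  rw_trans P z z' = \sum_(i < N | target z i == z') weight i.
Proof.
rewrite big_mkcond /rw_trans /target; case: ifPn => _.
  rewrite [RHS]big_ord_recr /= /weight !ltnn; congr (_ + _).
    apply: eq_bigr => i _; by rewrite ltn_ord eq_sym.
  by rewrite eq_sym.
have [_|_] := eqVneq z z'; first by rewrite -[LHS]cumulN.
by rewrite big1.
Qed.

Let branchP (v : R) i : 0 <= v < 1 -> (i < N)%N ->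
  reflect (branch v = i) (cumul i <= v < cumul i.+1).
Proof.
move=> /andP[v0 v1] iN.
have hasb : has (fun i => v < cumul i.+1) (iota 0 N).
  by apply/hasP; exists N.-1; rewrite ?mem_iota ?leq0n//= ?add0n// cumulN.
have bN : (branch v < N)%N by move: hasb; rewrite has_find size_iota.
have h1 : v < cumul (branch v).+1.
  by have := nth_find 0%N hasb; rewrite nth_iota// add0n.
have h2 : cumul (branch v) <= v.
  case E : (branch v) => [|b]; first by rewrite /cumul big_ord0.
  have bb : (b < branch v)%N by rewrite E.
  have := before_find 0%N bb.
  rewrite nth_iota ?add0n; last by rewrite (ltn_trans _ bN) // E.
  by move/negbT; rewrite -leNgt.
apply: (iffP idP) => [/andP[h3 h4]|<-]; last by rewrite h1 h2.
apply/eqP; rewrite eqn_leq; apply/andP; split; rewrite leqNgt; apply/negP => h.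
- have := cumul_le h (ltnW bN); lra.
- have := cumul_le h (ltnW iN); lra.
Qed.

Let code (n : nat) (s : nat -> int) : set R :=
  [set v | 0 <= v < 1 /\ cylinder n s (decode (s 0%N) v)].

Let piece (n : nat) (s : nat -> int) (i : nat) : set R :=
  `[cumul i, cumul i.+1[ `&`
  ((fun v => (v - cumul i) / weight i) @^-1` code n (fun j => s j.+1)).

Let codeS n s :
  code n.+1 s = \big[setU/set0]_(i < N | target (s 0%N) i == s 1%N) piece n s i.
Proof.
have decodeS z v i : decode z v i.+1 =
    decode (target z (branch v)) ((v - cumul (branch v)) / weight (branch v)) i.
  by rewrite /decode iterSr.
rewrite -bigcup_seq_cond; apply/seteqP; split => v.
- move=> [v01 vs].
  have hasb : exists2 i, (i < N)%N & cumul i <= v < cumul i.+1.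
    have bN : (branch v < N)%N.
      rewrite /branch -[X in (_ < X)%N](size_iota 0 N) -has_find.
      apply/hasP; exists N.-1; rewrite ?mem_iota ?leq0n//= ?add0n// cumulN.
      by case/andP: v01.
    by exists (branch v) => //; exact/(branchP v01 bN).
  have [i iN hi] := hasb; have /branchP bi := hi.
  have {}bi := bi v01 iN.
  exists (Ordinal iN) => /=.
    rewrite mem_index_enum /=; apply/eqP.
    by have := vs 1%N isT; rewrite decodeS bi.
  split; first by rewrite /= in_itv.
  have ts : target (s 0%N) i = s 1%N by have := vs 1%N isT; rewrite decodeS bi.
  have wi : 0 < weight i by have := cumulS i; lra.
  split.
    by rewrite ler_pdivlMr// ltr_pdivrMr// mul0r mul1r; have := cumulS i; lra.
  by move=> j jn; have := vs j.+1 jn; rewrite decodeS bi ts.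
- move=> [[i iN] /= /andP[_ /eqP ts]] [/=]; rewrite in_itv/= => hi [_ vs].
  have v01 : 0 <= v < 1.
    have := cumul_le (leq0n i) (ltnW iN); rewrite {1}/cumul big_ord0.
    have := cumul_le iN (leqnn N); rewrite cumulN; lra.
  have /(branchP v01 iN) bi := hi.
  split => // -[|j] jn; first by [].
  by rewrite decodeS bi ts; exact: vs.
Qed.

Let measure_code n s :
  measurable (code n s) /\
  mu (code n s) = (\prod_(i < n) rw_trans P (s i) (s i.+1))%:E.
Proof.
elim: n s => [|n IHn] s.
  have -> : code 0 s = `[0, 1[%classic.
    apply/seteqP; split => v /=; rewrite in_itv/=; first by case.
    by move=> v01; split => // i; rewrite leqn0 => /eqP ->.
  split; first exact: measurable_itv.
  by rewrite lebesgue_measure_itv/= lte_fin ltr01 big_ord0 -EFinD subr0.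
have [mC muC] := IHn (fun j => s j.+1).
have mP (i : 'I_N) : measurable (piece n s i).
  apply: measurableI; first exact: measurable_itv.
  rewrite -[X in measurable X]setTI.
  have : measurable_fun [set: R] (fun v : R => (v - cumul i) / weight i).
    by apply: measurable_funM => //; exact: measurable_funB.
  by move=> mf; apply: mf.
have muP (i : 'I_N) : mu (piece n s i) =
    (weight i * \prod_(i < n) rw_trans P (s i.+1) (s i.+2))%:E.
  have := weight_ge0 (ltn_ord i); rewrite le_eqVlt => /predU1P[w0|w0].
    rewrite /piece cumulS -w0 addr0 mul0r set_itvco0 set0I measure0//.
  rewrite EFinM -muC -(@lebesgue_measure_affine R (cumul i)) //.
  congr mu; apply/setIidr => v [] /=.
  rewrite ler_pdivlMr// ltr_pdivrMr// mul0r mul1r in_itv/= cumulS => ? _.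
  by lra.
have tP : trivIset setT (fun i : 'I_N => piece n s i).
  apply/trivIsetP => i j _ _ ij; rewrite /piece.
  apply/seteqP; split => // v [[vi _] [vj _]].
  move: vi vj; rewrite /= !in_itv /= => vi vj.
  have v01 : 0 <= v < 1.
    have := cumul_le (leq0n i) (ltnW (ltn_ord i)); rewrite {1}/cumul big_ord0.
    have := cumul_le (ltn_ord i) (leqnn N); rewrite cumulN; lra.
  move: vi vj => /(branchP v01 (ltn_ord i)) bi /(branchP v01 (ltn_ord j)) bj.
  by move/eqP: ij; apply; apply/val_inj; rewrite /= -bi -bj.
rewrite codeS; split; first exact: bigsetU_measurable.
rewrite measure_bigsetU_ord// (eq_bigr _ (fun i _ => muP i)) sumEFin.
by rewrite -mulr_suml -trans_target big_ord_recl.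
Qed.

Lemma exists_run_measure (x : int) :
  exists Q : probability run R, is_run_measure P x Q.
Proof.
pose I01 : set R := `[0, 1[%classic.
have mI : measurable I01 by exact: measurable_itv.
pose f (v : measurableTypeR R) : run := decode x (if 0 <= v < 1 then v else 0).
have preim n s : I01 `&` f @^-1` cylinder n s =
    if s 0%N == x then code n s else set0.
  case: ifPn => [/eqP sx|sx]; apply/seteqP; split => v //=.
  - by rewrite /I01 /= in_itv/= => -[v01]; rewrite /f v01 -sx.
  - by case=> v01 vs; rewrite /I01 /= in_itv/= v01; split=> //; rewrite /f v01 -sx.
  - by move=> [_ /(_ 0%N isT)] e; move: sx; rewrite -e eqxx.
have mf : measurable_fun [set: measurableTypeR R] f.
  apply: (@measurability _ _ (measurableTypeR R) run setT f cylinders) => //.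
  move=> _ [_ [n [s ->]] <-]; rewrite setTI.
  rewrite -[X in measurable X](setUIDK _ I01).
  rewrite setIC preim; apply: measurableU.
    by case: ifP => // _; exact: (measure_code n s).1.
  have [s0|s0] := pselect (cylinder n s (decode x 0)).
    rewrite (_ : _ `\` _ = ~` I01); first exact: measurableC.
    apply/seteqP; split => v /=; first by case.
    rewrite /I01 /= in_itv/= => /negP/negbTE v01; split; first by rewrite /f v01.
    by rewrite v01.
  rewrite (_ : _ `\` _ = set0) //.
  apply/seteqP; split => v //= -[]; rewrite /I01 /= in_itv/=.
  by rewrite /f; case: ifP.
pose Q0 : {measure set run -> \bar R} :=
  measure_function_pushforward__canonical__measure_function_Measure
    (mrestr lebesgue_measure mI) mf.
have Q0E n s : Q0 (cylinder n s) =
    (if s 0%N == x then \prod_(i < n) rw_trans P (s i) (s i.+1) else 0)%:E.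
  rewrite /Q0 /= /pushforward /mrestr setIC preim.
  by case: ifP => _; rewrite ?measure0// (measure_code n s).2.
have Q0T : Q0 setT = 1%E.
  rewrite /Q0 /= /pushforward /mrestr preimage_setT setTI.
  by rewrite lebesgue_measure_itv/= lte_fin ltr01 -EFinD subr0.
exists (mnormalize Q0 point) => n s /=.
by rewrite /mnormalize Q0T onee_eq0 /= invr1 mule1 Q0E.
Qed.

End run_measure_existence.

Section expected_runtime.
Context {R : realType} (P : rw_program R).

(* The run measure is determined by its values on cylinders, which form (with
   the empty set) a pi-system generating the sigma-algebra of [run]. *)
Definition run_measure (x : int) : probability run R :=
  sval (cid (exists_run_measure P x)).

Lemma run_measureP (x : int) : is_run_measure P x (run_measure x).
Proof. exact: svalP (cid (exists_run_measure P x)). Qed.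

(* [ereal_inf set0 = +oo], for the runs that never terminate. *)
Definition termination_time (w : run) : \bar R :=
  ereal_inf [set n%:R%:E | n in [set n | w n <= 0]].

Definition expected_runtime (x : int) : \bar R :=
  if run_measure x [set w | (termination_time w < +oo)%E] == 1%E
  then (\int[run_measure x]_w termination_time w)%E
  else +oo%E.

Definition positively_ast : Prop :=
  forall x : int, (expected_runtime x < +oo)%E.

End expected_runtime.

Section closed_form.
Context {R : realType} (P : rw_program R).

Definition rw_charpoly : {poly R[i]} :=
  \sum_(i < (rw_k P + rw_m P).+1) (rw_p P (i%:Z - (rw_k P)%:Z))%:C *: 'X^i
  - 'X^(rw_k P).

Definition rw_drift : R :=
  \sum_(i < (rw_k P + rw_m P).+1)
     (i%:Z - (rw_k P)%:Z)%:~R * rw_p P (i%:Z - (rw_k P)%:Z).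

(* When [rw_p' P = 0] and the program is positively almost surely terminating,
   [rw_drift P] is negative, so no division by zero occurs. *)
Definition rw_C (x : int) : R :=
  if 0 < rw_p' P then 1 / rw_p' P else - (1 / rw_drift) * x%:~R.

Definition rw_ansatz (c : nat) (lam : 'I_c -> R[i]) (v : 'I_c -> nat)
    (a : 'I_c -> nat -> R[i]) (x : int) : R[i] :=
  (rw_C x)%:C +
  \sum_(j < c | `|lam j| <= 1)
    \sum_(u < v j) a j u * lam j ^ x * x%:~R ^+ u.

End closed_form.

(* Main.v *)
From HB Require Import structures.
Require Import Defs.
From mathcomp Require Import all_boot all_order all_algebra.
From mathcomp Require Import complex.
From mathcomp Require Import all_classical all_reals all_analysis.
From mathcomp Require Import measurable_realfun ring lra zify.

Set Implicit Arguments.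
Unset Strict Implicit.
Unset Printing Implicit Defensive.

Import Order.TTheory GRing.Theory Num.Theory.
Import numFieldNormedType.Exports.

Local Open Scope ring_scope.
Local Open Scope complex_scope.

(* The expected runtime is the sum over [n] of the probabilities of being alive
   at time [n], hence a solution of the recurrence obtained by conditioning on
   the first step, and its difference to the particular solution [rw_C] solves
   the homogeneous recurrence with characteristic polynomial chi. As this
   difference grows at most linearly, the factors of chi with roots outside the
   closed unit disk can be cancelled, so that it is a combination of the
   [lam j ^ x * x ^ u] with [|lam j| <= 1]. Such combinations are bounded on the
   positive integers, since the roots on the unit circle are simple; by the
   maximum principle for the almost surely terminating walk, one that vanishes
   for [- k < x <= 0] vanishes identically, which gives uniqueness by linear
   independence. *)

(** * Linear recurrences with constant coefficients *)

Section shift_action.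
Context {R : comNzRingType}.
Implicit Types (p q : {poly R}) (f : int -> R) (a z : R) (x : int).

Definition shift_act p f x : R := \sum_(i < size p) p`_i * f (x + i%:Z).

Lemma shift_act_widen n p f x : (size p <= n)%N ->
  shift_act p f x = \sum_(i < n) p`_i * f (x + i%:Z).
Proof.
move=> pn; rewrite /shift_act (big_ord_widen n (fun i => p`_i * f (x + i%:Z)) pn).
rewrite big_mkcond; apply: eq_bigr => i _.
by case: ltnP => // pi; rewrite nth_default// mul0r.
Qed.

Lemma shift_act1 f x : shift_act 1 f x = f x.
Proof. by rewrite /shift_act size_poly1 big_ord1 coef1 mul1r addr0. Qed.

Lemma shift_actD p q f x :
  shift_act (p + q) f x = shift_act p f x + shift_act q f x.
Proof.
pose n := maxn (size p) (size q).
rewrite !(@shift_act_widen n) ?leq_maxl ?leq_maxr ?size_polyD// -big_split.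
by apply: eq_bigr => i _; rewrite coefD mulrDl.
Qed.

Lemma shift_actZ a p f x : shift_act (a *: p) f x = a * shift_act p f x.
Proof.
rewrite (@shift_act_widen (size p)) ?size_scale_leq// mulr_sumr.
by apply: eq_bigr => i _; rewrite coefZ mulrA.
Qed.

Lemma shift_actMX p f x : shift_act (p * 'X) f x = shift_act p f (x + 1).
Proof.
rewrite (@shift_act_widen (size p).+1) ?(leq_trans (size_polyMleq _ _))//; last first.
  by rewrite size_polyX addn2.
rewrite big_ord_recl coefMX eqxx mul0r add0r; apply: eq_bigr => i _.
by rewrite coefMX -addrA.
Qed.

Lemma shift_actM p q f x :
  shift_act (p * q) f x = shift_act p (shift_act q f) x.
Proof.
elim/poly_ind: p x => [|p a IHp] x.
  by rewrite mul0r /shift_act size_poly0 !big_ord0.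
rewrite mulrDl mulrAC mul_polyC -[a%:P]alg_polyC.
by rewrite !shift_actD !shift_actMX IHp !shift_actZ shift_act1.
Qed.

Lemma shift_act_XsubC z f x : shift_act ('X - z%:P) f x = f (x + 1) - z * f x.
Proof.
rewrite /shift_act size_XsubC 2!big_ord_recl big_ord0 addr0 /=.
by rewrite polyseqXsubC /= mulNr mul1r addr0 addrC.
Qed.

Lemma shift_act_sum (I : Type) (s : seq I) p (F : I -> int -> R) x :
  shift_act p (fun t => \sum_(j <- s) F j t) x = \sum_(j <- s) shift_act p (F j) x.
Proof.
by rewrite exchange_big; apply: eq_bigr => i _; rewrite mulr_sumr.
Qed.

Lemma shift_actB p f g x :
  shift_act p (fun t => f t - g t) x = shift_act p f x - shift_act p g x.
Proof. by rewrite -sumrB; apply: eq_bigr => i _; rewrite mulrBr. Qed.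

End shift_action.

Lemma triangular_surjective (F : fieldType) (L : {poly F} -> {poly F}) e :
  linear L -> (forall n, size (L 'X^(n + e)) = n.+1) ->
  forall r : {poly F}, exists2 q : {poly F}, (size q <= size r + e)%N & L q = r.
Proof.
move=> Llin sizeL r; have [d] := ubnP (size r); elim: d r => // d IHd r rd.
have [->|r0] := eqVneq r 0.
  exists 0; first by rewrite size_poly0.
  by have := Llin (-1) 0 0; rewrite scaler0 addr0 scaleN1r addNr.
pose n := (size r).-1; pose M : {poly F} := 'X^(n + e).
have rE : size r = n.+1 by rewrite /n prednK// lt0n size_poly_eq0.
have leadM : (L M)`_n != 0.
  rewrite (_ : n = (size (L M)).-1) -?lead_coefE ?lead_coef_eq0 ?sizeL//.
  by rewrite -size_poly_eq0 sizeL.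
have [|q qd qE] := IHd (r - (r`_n / (L M)`_n) *: L M).
  rewrite -ltnS (leq_trans _ rd)// rE ltnS; apply/leq_sizeP => k.
  rewrite leq_eqVlt coefB coefZ => /predU1P[<-|nk]; first by rewrite divfK// subrr.
  have -> : r`_k = 0 by rewrite nth_default ?rE.
  by rewrite [(L M)`_k]nth_default ?sizeL// mulr0 subrr.
exists ((r`_n / (L M)`_n) *: M + q); last by rewrite Llin qE addrC subrK.
rewrite (leq_trans (size_polyD _ _))// geq_max (leq_trans (size_scale_leq _ _)) /=.
  rewrite (leq_trans qd)// leq_add2r (leq_trans (size_polyD _ _))// size_polyN.
  by rewrite geq_max leqnn (leq_trans (size_scale_leq _ _))// sizeL rE.
by rewrite size_polyXn rE addSn.
Qed.

Section exponential_sequences.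
Context {C : numFieldType}.
Implicit Types (p q r : {poly C}) (f : int -> C) (y z : C) (s : seq C).

Definition expseq y q (x : int) : C := y ^ x * q.[x%:~R].

Definition twisted_diff y z q : {poly C} := y *: (q \Po ('X + 1%:P)) - z *: q.

Lemma shift_act_XsubC_expseq y z q x : y != 0 ->
  shift_act ('X - z%:P) (expseq y q) x = expseq y (twisted_diff y z q) x.
Proof.
move=> y0; rewrite shift_act_XsubC /expseq /twisted_diff hornerD hornerN !hornerZ.
rewrite horner_comp hornerD hornerX hornerC expfzDr// expr1z intrD.
by rewrite (_ : 1%:~R = 1)//; ring.
Qed.

Lemma twisted_diff_linear y z : linear (twisted_diff y z).
Proof.
by move=> a q r; rewrite /twisted_diff comp_polyD comp_polyZ -!mul_polyC; ring.
Qed.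

Lemma coef_comp_XaddC1 n q : (size q <= n.+2)%N ->
  (q \Po ('X + 1%:P))`_n = q`_n + q`_n.+1 *+ n.+1.
Proof.
elim/poly_ind: q n => [|q a IHq] n; first by rewrite comp_poly0 !coef0 mul0rn addr0.
rewrite size_MXaddC; case: ifP => [/andP[/eqP-> /eqP->] _|_ qn].
  by rewrite mul0r addr0 comp_poly0 !coef0 mul0rn addr0.
have top : (q \Po ('X + 1%:P))`_n = q`_n.
  by rewrite IHq ?(ltnW qn)// [q`_n.+1]nth_default ?mul0rn ?addr0.
rewrite comp_poly_MXaddC mulrDr mulr1 !coefD !coefMX !coefC top /= addr0.
case: n qn {top} => [|n] qn /=; first by rewrite !add0r mulr1n addrC.
by rewrite IHq// !addr0 -addrA -mulrSr.
Qed.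

Lemma coef_twisted_diff y z q n : (size q <= n.+1 + (y == z))%N ->
  (twisted_diff y z q)`_n = (if y == z then y *+ n.+1 else y - z) * q`_(n + (y == z)).
Proof.
rewrite coefB !coefZ; have [<-|yz] := eqVneq y z => qn.
  rewrite !addn1 in qn *; rewrite coef_comp_XaddC1//.
  by rewrite mulrDr addrAC subrr add0r mulrnAr mulrnAl.
rewrite addn0 in qn; rewrite coef_comp_XaddC1 ?(leq_trans qn)// addn0.
by rewrite (nth_default _ qn) mul0rn addr0 mulrBl.
Qed.

Lemma size_twisted_diff y z q : y != 0 ->
  size (twisted_diff y z q) = (size q - (y == z))%N.
Proof.
move=> y0; apply/eqP; rewrite eqn_leq; apply/andP; split.
  apply/leq_sizeP => n; rewrite leq_subLR addnC => qn.
  by rewrite coef_twisted_diff ?(leq_trans qn) ?leq_add2r// nth_default ?mulr0.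
case E : (size q - (y == z))%N => [//|n].
have qE : size q = (n + (y == z)).+1 by lia.
rewrite ltnNge; apply/negP => /leq_sizeP/(_ n (leqnn n))/eqP.
rewrite coef_twisted_diff ?qE ?addSn// mulf_eq0 -[(n + _)%N]/((n + (y == z)).+1.-1).
rewrite -qE -lead_coefE lead_coef_eq0 -size_poly_eq0 qE orbF.
by case: (eqVneq y z) => [_|yz]; rewrite ?mulrn_eq0 ?(negbTE y0)// subr_eq0 (negbTE yz).
Qed.

Lemma twisted_diff_surjective y z r : y != 0 ->
  exists2 q : {poly C}, (size q <= size r + (y == z))%N & twisted_diff y z q = r.
Proof.
move=> y0; apply: triangular_surjective; first exact: twisted_diff_linear.
by move=> n; rewrite size_twisted_diff// size_polyXn -addSn addnK.
Qed.

Lemma shift_act_XsubCX_expseq_eq0 n y q x : y != 0 -> (size q <= n)%N ->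
  shift_act (('X - y%:P) ^+ n) (expseq y q) x = 0.
Proof.
move=> y0; elim: n q x => [|n IHn] q x qn.
  rewrite (_ : q = 0) ?shift_act1 /expseq ?horner0 ?mulr0//.
  by apply/eqP; rewrite -size_poly_eq0 -leqn0.
rewrite exprSr shift_actM -[RHS](IHn (twisted_diff y y q) x).
  by apply: eq_bigr => i _; rewrite shift_act_XsubC_expseq.
by rewrite size_twisted_diff// eqxx leq_subLR add1n.
Qed.

Lemma shift_act_expseq_eq0 p y q x : y != 0 -> ('X - y%:P) ^+ size q %| p ->
  shift_act p (expseq y q) x = 0.
Proof.
move=> y0 /dvdpP[p' ->]; rewrite shift_actM.
by apply: big1 => i _; rewrite shift_act_XsubCX_expseq_eq0 ?mulr0.
Qed.

Lemma expseq_eq0 x0 y q : y != 0 -> (forall x, x0 <= x -> expseq y q x = 0) -> q = 0.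
Proof.
move=> y0 yq0; apply/eqP/contraT => q0.
pose pts : seq C := [seq (x0 + k%:Z)%:~R | k <- iota 0 (size q)].
have : (size pts < size q)%N.
  apply: max_poly_roots => //; last first.
    by rewrite map_inj_uniq ?iota_uniq// => a b /eqP; rewrite eqr_int; lia.
  apply/allP => _ /mapP[k _ ->]; have /eqP := yq0 (x0 + k%:Z) ltac:(lia).
  by rewrite mulf_eq0 (negbTE (expfz_neq0 _ y0)).
by rewrite size_map size_iota ltnn.
Qed.

(* [f x / z ^ x] is constant. *)
Lemma shift_act_XsubC_eq0 z f x0 : z != 0 ->
  (forall x, x0 <= x -> shift_act ('X - z%:P) f x = 0) ->
  forall x, x0 <= x -> f x = expseq z (f x0 / z ^ x0)%:P x.
Proof.
move=> z0 fz x xx; rewrite /expseq hornerC mulrC.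
have -> : x = x0 + `|x - x0|%N%:Z by lia.
elim: (`|x - x0|%N) => [|n IHn]; first by rewrite addr0 divfK// expfz_neq0.
have /eqP := fz (x0 + n%:Z) ltac:(lia); rewrite shift_act_XsubC subr_eq0 => /eqP.
rewrite IHn; have -> : x0 + n.+1%:Z = x0 + n%:Z + 1 by lia.
by move=> ->; rewrite (expfzDr _ 1)// expr1z; ring.
Qed.

Section exponential_polynomials.
Context {I : finType} (lam : I -> C).
Hypothesis lam_neq0 : forall j, lam j != 0.
Implicit Types Q : I -> {poly C}.

Definition exppoly Q (x : int) : C := \sum_j expseq (lam j) (Q j) x.

Lemma exppolyD Q1 Q2 x :
  exppoly (fun j => Q1 j + Q2 j) x = exppoly Q1 x + exppoly Q2 x.
Proof.
by rewrite -big_split; apply: eq_bigr => j _; rewrite /expseq hornerD mulrDr.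
Qed.

Lemma exppolyB Q1 Q2 x :
  exppoly (fun j => Q1 j - Q2 j) x = exppoly Q1 x - exppoly Q2 x.
Proof.
by rewrite -sumrB; apply: eq_bigr => j _; rewrite /expseq hornerD hornerN mulrBr.
Qed.

Lemma exppoly_single j Q x : (forall i, i != j -> Q i = 0) ->
  exppoly Q x = expseq (lam j) (Q j) x.
Proof.
move=> Q0; rewrite /exppoly (bigD1 j)//= big1 ?addr0// => i ij.
by rewrite Q0// /expseq horner0 mulr0.
Qed.

Lemma shift_act_XsubC_exppoly z Q x :
  shift_act ('X - z%:P) (exppoly Q) x =
    exppoly (fun j => twisted_diff (lam j) z (Q j)) x.
Proof.
rewrite shift_act_sum; apply: eq_bigr => j _.
exact: shift_act_XsubC_expseq.
Qed.

Lemma shift_act_exppoly_eq0 p Q x : p != 0 ->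
  (forall j, size (Q j) <= mup (lam j) p)%N -> shift_act p (exppoly Q) x = 0.
Proof.
move=> p0 Qp; rewrite shift_act_sum big1// => j _.
by rewrite shift_act_expseq_eq0// -mup_geq.
Qed.

(* Applying ['X - (lam i)%:P] lowers the degree of [Q i] and preserves the
   other degrees, so that induction leaves a single nonzero polynomial. *)
Lemma exppoly_eq0 x0 Q : injective lam ->
  (forall x, x0 <= x -> exppoly Q x = 0) -> forall j, Q j = 0.
Proof.
move=> lam_inj; have [n] := ubnP (\sum_j size (Q j))%N; elim: n Q => // n IHn Q Qn Q0.
have [/forallP Q0' j|] := boolP [forall j, Q j == 0]; first exact/eqP.
rewrite negb_forall => /existsP[i Qi].
have Q'0 j : twisted_diff (lam j) (lam i) (Q j) = 0.
  apply: (IHn (fun j => twisted_diff (lam j) (lam i) (Q j))) => [|x xx]; last first.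
    by rewrite -shift_act_XsubC_exppoly shift_act_XsubC !Q0 ?mulr0 ?subr0//; lia.
  rewrite ltnS in Qn; rewrite (leq_trans _ Qn)// (bigD1 i)//= [ltnRHS](bigD1 i)//=.
  rewrite -addSn leq_add//; last first.
    by apply: leq_sum => k _; rewrite size_twisted_diff// leq_subr.
  by rewrite size_twisted_diff// eqxx ltn_subrL andTb lt0n size_poly_eq0.
have Qj j : j != i -> Q j = 0.
  move=> ji; apply/eqP; rewrite -size_poly_eq0.
  have := size_twisted_diff (lam i) (Q j) (lam_neq0 j).
  by rewrite Q'0 size_poly0 (inj_eq lam_inj) (negbTE ji) subn0 => <-.
case/eqP: Qi; apply: (expseq_eq0 (x0 := x0) (lam_neq0 i)) => x xx.
by rewrite -(exppoly_single _ Qj) Q0.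
Qed.

Lemma exppoly_of_shift_act x0 s f : {subset s <= codom lam} ->
  (forall x, x0 <= x -> shift_act (\prod_(z <- s) ('X - z%:P)) f x = 0) ->
  exists2 Q : I -> {poly C}, (forall j, size (Q j) <= count_mem (lam j) s)%N &
    forall x, x0 <= x -> f x = exppoly Q x.
Proof.
elim: s f => [|z s IHs] f slam fs.
  exists (fun=> 0) => [j|x xx]; first by rewrite size_poly0.
  rewrite -[LHS](shift_act1 f) -(big_nil 1 *%R predT (fun z : C => 'X - z%:P)) fs//.
  by rewrite /exppoly big1// => j _; rewrite /expseq horner0 mulr0.
have [||Q sQ QE] := IHs (shift_act ('X - z%:P) f).
- by move=> t ts; apply: slam; rewrite inE ts orbT.
- by move=> x /fs; rewrite big_cons mulrC shift_actM.
have /codomP[i zi] := slam z (mem_head _ _).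
have /boolp.choice[Q' Q'P] j : exists q : {poly C},
    (size q <= count_mem (lam j) (z :: s))%N /\ twisted_diff (lam j) z q = Q j.
  have [q sq qQ] := twisted_diff_surjective z (Q j) (lam_neq0 j).
  by exists q; rewrite /= addnC eq_sym (leq_trans sq)// leq_add2r.
have z0 : z != 0 by rewrite zi.
have /(shift_act_XsubC_eq0 z0) gE : forall x, x0 <= x ->
    shift_act ('X - z%:P) (fun t => f t - exppoly Q' t) x = 0.
  move=> x xx; rewrite shift_actB QE// shift_act_XsubC_exppoly -exppolyB.
  by rewrite /exppoly big1// => j _; rewrite (Q'P j).2 subrr /expseq horner0 mulr0.
set a := (_ / _) in gE; pose Q0 j : {poly C} := if j == i then a%:P else 0.
exists (fun j => Q' j + Q0 j) => [j|x xx].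
  rewrite (leq_trans (size_polyD _ _))// geq_max (Q'P j).1 /= /Q0.
  case: eqP => [->|_]; last by rewrite size_poly0.
  by rewrite -zi eqxx (leq_trans (size_polyC_leq1 _)).
have Q0i j : j != i -> Q0 j = 0 by rewrite /Q0 => /negbTE->.
rewrite exppolyD (exppoly_single _ Q0i).
by rewrite /Q0 eqxx -zi -gE// addrC subrK.
Qed.

End exponential_polynomials.
End exponential_sequences.

Lemma normr_exprz (F : numFieldType) (z : F) (n : int) : `|z ^ n| = `|z| ^ n.
Proof. by case: n => n; rewrite /exprz ?normfV normrX. Qed.

Lemma bernoulli_inequality (F : numDomainType) (e : F) n :
  0 <= e -> 1 + n%:R * e <= (1 + e) ^+ n.
Proof.
move=> e0; elim: n => [|n IHn]; first by rewrite mul0r addr0.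
rewrite exprS (le_trans _ (ler_wpM2l (addr_ge0 ler01 e0) IHn))//.
have : 0 <= n%:R * e ^+ 2 by rewrite mulr_ge0 ?exprn_ge0.
rewrite -subr_ge0; congr (0 <= _).
by rewrite -(natr1 n); ring.
Qed.

Lemma geometric_unbounded (F : archiNumFieldType) (q a K : F) :
  1 < q -> 0 <= a -> (forall n, a * q ^+ n <= K) -> a = 0.
Proof.
move=> q1 a0 aK; apply/eqP/contraT => an0.
have {an0}a0 : 0 < a by rewrite lt_def an0.
have q0 : 0 < q - 1 by rewrite subr_gt0.
have K0 : 0 <= K by rewrite (le_trans _ (aK 0%N))// expr0 mulr1 ltW.
have := archi_boundP (divr_ge0 K0 (ltW (mulr_gt0 a0 q0))).
set n := Num.bound _; rewrite ltr_pdivrMr ?mulr_gt0// => /lt_geF <-.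
rewrite (le_trans _ (aK n))// mulrCA ler_pM2l//.
have := bernoulli_inequality n (ltW q0); rewrite [1 + (q - 1)]addrC subrK.
by apply: le_trans; rewrite lerDr.
Qed.

Section growth.
Context {C : archiNumFieldType}.
Implicit Types (p : {poly C}) (f : int -> C) (z : C) (s : seq C).

Definition subexponential (x0 : int) f : Prop :=
  forall r : C, 1 < r -> exists K : C, forall n : nat, `|f (x0 + n%:Z)| <= K * r ^+ n.

Lemma linear_subexponential x0 f (K : C) :
  (forall n : nat, `|f (x0 + n%:Z)| <= K * n.+1%:R) -> subexponential x0 f.
Proof.
move=> fK r r1; have r0 : 0 < r - 1 by rewrite subr_gt0.
have K0 : 0 <= K by have := le_trans (normr_ge0 _) (fK 0%N); rewrite mulr1.
exists (K * (1 + (r - 1)^-1)) => n; rewrite (le_trans (fK n))// -mulrA ler_wpM2l//.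
have := bernoulli_inequality n (ltW r0); rewrite [1 + (r - 1)]addrC subrK => rn.
rewrite mulrDl mul1r -natr1 addrC lerD//.
  by rewrite (le_trans _ rn)// lerDl mulr_ge0// ltW.
by rewrite mulrC ler_pdivlMr// (le_trans _ rn)// lerDr.
Qed.

Lemma subexponential_shift_act x0 p f :
  subexponential x0 f -> subexponential x0 (shift_act p f).
Proof.
move=> fsub r r1; have [K fK] := fsub r r1.
exists (\sum_(i < size p) `|p`_i| * K * r ^+ i) => n.
rewrite (le_trans (ler_norm_sum _ _ _))// mulr_suml; apply: ler_sum => i _.
rewrite normrM -!mulrA ler_wpM2l// -exprD addnC.
by have -> : x0 + n%:Z + i%:Z = x0 + (n + i)%:Z by lia.
Qed.

Lemma subexponential_expseqC_eq0 x0 z a : 1 < `|z| ->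
  subexponential x0 (expseq z a%:P) -> a = 0.
Proof.
move=> z1 zsub; have z0 : z != 0 by rewrite -normr_gt0 (lt_trans _ z1).
pose r := (1 + `|z|) / 2.
have /andP[r1 rz] : 1 < r < `|z| by rewrite !midf_lt.
have r0 : 0 < r by rewrite (lt_trans _ r1).
have [K zK] := zsub r r1.
suff : `|z ^ x0 * a| = 0.
  by move/eqP; rewrite normr_eq0 mulf_eq0 (negbTE (expfz_neq0 _ z0)) => /eqP.
apply: (@geometric_unbounded _ (`|z| / r) _ K) => // [|n].
  by rewrite ltr_pdivlMr// mul1r.
rewrite expr_div_n mulrA ler_pdivrMr ?exprn_gt0// -normrX -normrM mulrAC.
by have := zK n; rewrite /expseq hornerC expfzDr.
Qed.

Lemma subexponential_shift_act_eq0 x0 s f : {in s, forall z, 1 < `|z|} ->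
  subexponential x0 f ->
  (forall x, x0 <= x -> shift_act (\prod_(z <- s) ('X - z%:P)) f x = 0) ->
  forall x, x0 <= x -> f x = 0.
Proof.
elim: s f => [|z s IHs] f s1 fsub fs x xx.
  by rewrite -[LHS]shift_act1 -[RHS](fs x xx) big_nil.
have z1 : 1 < `|z| by apply: s1; rewrite mem_head.
have z0 : z != 0 by rewrite -normr_gt0 (lt_trans _ z1).
have /(shift_act_XsubC_eq0 z0) fE : forall x, x0 <= x -> shift_act ('X - z%:P) f x = 0.
  apply: IHs => [t ts||t /fs]; first by apply: s1; rewrite inE ts orbT.
    exact: subexponential_shift_act.
  by rewrite big_cons mulrC shift_actM.
rewrite fE// (_ : _ / _ = 0) ?/expseq ?horner0 ?mulr0//.
apply: (@subexponential_expseqC_eq0 x0 z) => // r r1.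
by have [K fK] := fsub r r1; exists K => n; rewrite -fE//; lia.
Qed.

Definition bounded_from (x0 : int) f : Prop :=
  exists M : C, forall n : nat, `|f (x0 + n%:Z)| <= M.

Lemma expseq_bounded x0 z (q : {poly C}) : z != 0 -> `|z| < 1 ->
  bounded_from x0 (expseq z q).
Proof.
move=> z0 z1; have [d] := ubnP (size q); elim: d q => // d IHd q qd.
have [->|q0] := eqVneq q 0.
  by exists 0 => n; rewrite /expseq horner0 mulr0 normr0.
have [|M MP] := IHd (twisted_diff z z q).
  rewrite size_twisted_diff// eqxx -ltnS (leq_trans _ qd)// ltnS ltn_subrL /=.
  by rewrite lt0n size_poly_eq0.
have z1' : 0 < 1 - `|z| by rewrite subr_gt0.
have M0 : 0 <= M by rewrite (le_trans _ (MP 0%N)).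
pose a := `|expseq z q x0|.
exists (a + M / (1 - `|z|)) => n; elim: n => [|n IHn].
  by rewrite addr0 lerDl divr_ge0// ltW.
have -> : x0 + n.+1%:Z = x0 + n%:Z + 1 by lia.
rewrite -[expseq _ _ _](subrK (z * expseq z q (x0 + n%:Z))) -shift_act_XsubC.
rewrite shift_act_XsubC_expseq// (le_trans (ler_normD _ _))// (normrM z).
rewrite (le_trans (lerD (MP n) (ler_wpM2l (normr_ge0 z) IHn)))//.
have -> : M + `|z| * (a + M / (1 - `|z|)) = `|z| * a + M / (1 - `|z|).
  by field; rewrite gt_eqF.
by rewrite lerD2r ler_piMl ?normr_ge0// ltW.
Qed.

Lemma exppoly_bounded (I : finType) (lam : I -> C) (Q : I -> {poly C}) x0 :
  (forall j, lam j != 0) ->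
  (forall j, 1 < `|lam j| -> Q j = 0) ->
  (forall j, `|lam j| = 1 -> (size (Q j) <= 1)%N) ->
  bounded_from x0 (exppoly lam Q).
Proof.
move=> lam0 Qgt1 Q1.
have /boolp.choice[M MP] j : bounded_from x0 (expseq (lam j) (Q j)).
  have [l1|l1|l1] := real_ltgtP (normr_real (lam j)) (@real1 C).
  - exact: expseq_bounded.
  - by exists 0 => n; rewrite Qgt1// /expseq horner0 mulr0 normr0.
  - exists `|(Q j)`_0| => n; rewrite /expseq (size1_polyC (Q1 j l1)) hornerC coefC eqxx.
    by rewrite normrM normr_exprz l1 exp1rz mul1r.
exists (\sum_j M j) => n; rewrite (le_trans (ler_norm_sum _ _ _))//=.
by apply: ler_sum => j _; exact: MP.
Qed.

End growth.

Section stable_solutions.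
Context {C : archiClosedFieldType} (p : {poly C}) {I : finType} (lam : I -> C).
Hypothesis p_neq0 : p != 0.
Hypothesis lam_neq0 : forall j, lam j != 0.

Definition stable_mup (z : C) : nat := if `|z| <= 1 then mup z p else 0%N.

Definition stable_family (Q : I -> {poly C}) : Prop :=
  forall j, (size (Q j) <= stable_mup (lam j))%N.

Lemma stable_familyB (Q1 Q2 : I -> {poly C}) :
  stable_family Q1 -> stable_family Q2 -> stable_family (fun j => Q1 j - Q2 j).
Proof.
move=> sQ1 sQ2 j.
by rewrite (leq_trans (size_polyD _ _))// size_polyN geq_max sQ1 sQ2.
Qed.

Lemma shift_act_stable_eq0 (Q : I -> {poly C}) x :
  stable_family Q -> shift_act p (exppoly lam Q) x = 0.
Proof.
move=> sQ; apply: shift_act_exppoly_eq0 => // j; rewrite (leq_trans (sQ j))//.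
by rewrite /stable_mup; case: ifP.
Qed.

Lemma stable_exppoly_bounded (Q : I -> {poly C}) x0 :
  (forall z, `|z| = 1 -> (mup z p <= 1)%N) ->
  stable_family Q -> bounded_from x0 (exppoly lam Q).
Proof.
move=> simple sQ; apply: exppoly_bounded => // j l1; have := sQ j; rewrite /stable_mup.
  by rewrite lt_geF// leqn0 size_poly_eq0 => /eqP.
by rewrite l1 lexx => /leq_trans; apply; exact: simple.
Qed.

Lemma stable_factorization : exists r1 r2 : seq C,
  [/\ {in r1, forall z, root p z}, {in r2, forall z, 1 < `|z|},
      forall z, count_mem z r1 = stable_mup z &
      p = lead_coef p *:
        ((\prod_(z <- r2) ('X - z%:P)) * (\prod_(z <- r1) ('X - z%:P)))].
Proof.
have [r rE] := closed_field_poly_normal p.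
exists [seq z <- r | `|z| <= 1], [seq z <- r | ~~ (`|z| <= 1)]; split.
- move=> z; rewrite mem_filter => /andP[_ zr].
  by rewrite rE rootZ ?lead_coef_eq0// root_prod_XsubC.
- by move=> z; rewrite mem_filter real_ltNge ?normr_real ?real1// => /andP[].
- move=> z; have mupE : mup z p = count_mem z r.
    rewrite {1}rE -mul_polyC mupMr ?rootC ?lead_coef_eq0//; exact: mu_prod_XsubC.
  rewrite /stable_mup count_filter mupE.
  have [z1|z1] := ifP.
    by apply: eq_count => t /=; case: eqP => //= ->.
  rewrite -(@count_pred0 _ r); apply: eq_count => t /=.
  by case: eqP => //= ->; rewrite z1.
- rewrite [LHS]rE mulrC -big_cat; congr (_ *: _).
  by apply: perm_big; rewrite perm_sym perm_filterC.
Qed.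

(* The factors of [p] with roots outside the closed unit disk act injectively on
   subexponential sequences, hence can be cancelled. *)
Lemma subexponential_recurrence x0 (f : int -> C) :
  (forall z, root p z -> z \in codom lam) ->
  subexponential x0 f -> (forall x, x0 <= x -> shift_act p f x = 0) ->
  exists2 Q, stable_family Q & forall x, x0 <= x -> f x = exppoly lam Q x.
Proof.
move=> p_lam fsub pf; have [r1 [r2 [r1p r2gt1 countr1 pE]]] := stable_factorization.
have r1f : forall x, x0 <= x -> shift_act (\prod_(z <- r1) ('X - z%:P)) f x = 0.
  apply: (subexponential_shift_act_eq0 r2gt1); first exact: subexponential_shift_act.
  move=> x xx; have /eqP := pf x xx; rewrite pE shift_actZ shift_actM mulf_eq0.
  by rewrite lead_coef_eq0 (negbTE p_neq0) => /eqP.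
have [|Q sQ fQ] := exppoly_of_shift_act lam_neq0 _ r1f.
  by move=> z /r1p /p_lam.
by exists Q => // j; rewrite -countr1.
Qed.

End stable_solutions.

(** * Survival probabilities of the random walk *)

Local Open Scope classical_set_scope.

Lemma measure_setI_partition d (T : measurableType d) (R : realType)
    (mu : {measure set T -> \bar R}) (I : choiceType) (s : seq I)
    (D A : set T) (B : I -> set T) :
  measurable D -> (mu D < +oo)%E -> measurable A -> (forall i, measurable (B i)) ->
  uniq s -> trivIset [set` s] B -> (forall i, B i `<=` D) ->
  mu D = (\sum_(i <- s) mu (B i))%E ->
  mu (D `&` A) = (\sum_(i <- s) mu (B i `&` A))%E.
Proof.
move=> mD Dfin mA mB us tB BD muD.
have sumE (F : I -> set T) : (forall i, measurable (F i)) -> trivIset [set` s] F ->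
    mu (\bigcup_(i in [set` s]) F i) = (\sum_(i <- s) mu (F i))%E.
  move=> mF tF; rewrite measure_fin_bigcup; [|exact: finite_seq|exact: tF|by []].
  by rewrite -fsbig_seq.
pose U := \bigcup_(i in [set` s]) B i.
have mU : measurable U by apply: fin_bigcup_measurable => //; exact: finite_seq.
have UD : U `<=` D by apply: bigcup_sub.
have muU : mu U = mu D by rewrite muD /U sumE.
have muDU : mu (D `\` U) = 0%E.
  rewrite (measureD mD mU Dfin) setIidr// [X in (_ - X)%E]muU.
  by apply: subee; rewrite ge0_fin_numE.
have mDA : measurable (D `&` A) by exact: measurableI.
have muDAU : mu (D `&` A `\` U) = 0%E.
  apply: (subset_measure0 _ _ _ muDU); [exact: measurableD|exact: measurableD|].
  by move=> t [[]].
rewrite (measureDI mu mDA mU) [X in (X + _)%E]muDAU add0e.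
rewrite -setIA (setIC A) setIA (setIidr UD) setI_bigcupl -sumE// => [i|].
  exact: measurableI.
exact: trivIset_setIr.
Qed.

Lemma measurable_cylinder n s : measurable (cylinder n s : set run).
Proof. by apply: sub_gen_smallest; exists n, s. Qed.

Lemma measurable_coord i (A : set int) : measurable [set w : run | A (w i)].
Proof.
rewrite (_ : [set _ | _] = \bigcup_(t : seq int)
    (if `[< A (nth 0 t i) >] then cylinder i (nth 0 t) : set run else set0)).
  apply: countable_bigcupT_measurable => [|t]; first exact: countableP.
  by case: ifP => // _; exact: measurable_cylinder.
apply/seteqP; split => w /=.
  move=> Aw; exists (mkseq w i.+1) => //.
  rewrite nth_mkseq// asboolT// => j ji.
  by rewrite nth_mkseq.
by move=> [t _]; case: ifPn => // /asboolP At /(_ i (leqnn i)) ->.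
Qed.

Definition alive (l n : nat) : set run :=
  [set w | forall i, (l <= i <= n)%N -> 0 < w i].

Lemma measurable_alive l n : measurable (alive l n).
Proof.
rewrite (_ : alive l n =
  \bigcap_(i in [set i | (l <= i <= n)%N]) [set w : run | 0 < w i])//.
apply: bigcap_measurableType => i _.
exact: (measurable_coord i [set z | 0 < z]).
Qed.

Definition extend_path (l : nat) (s : nat -> int) (z : int) (i : nat) : int :=
  if (i <= l)%N then s i else z.

Lemma cylinder_extend l s z :
  cylinder l.+1 (extend_path l s z) = cylinder l s `&` [set w | w l.+1 = z].
Proof.
apply/seteqP; split => w /= => [ws|[ws wz] i].
  split=> [i il|]; first by rewrite ws ?/extend_path ?il// leqW.
  by rewrite ws// /extend_path ltnn.
rewrite /extend_path => il; case: leqP => [/ws //|li].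
by have -> : i = l.+1 by lia.
Qed.

Lemma cylinder_alive_eq0 l n (s : nat -> int) : (l <= n)%N -> s l <= 0 ->
  cylinder l s `&` alive l n = set0.
Proof.
move=> ln sl; apply/seteqP; split => // w [ws] /(_ l).
by rewrite ws// leqnn ln ltNge sl => /(_ isT).
Qed.

Section termination_time.
Context {R : realType}.

Lemma nneseries_ltn m : (\sum_(0 <= n <oo) ((n < m)%N%:R : R)%:E = m%:R%:E)%E.
Proof.
rewrite (nneseries_split 0 m) => [|n _]; last by rewrite lee_fin.
rewrite add0n [X in (_ + X)%E]eseries0 ?adde0 => [|n mn _]; last by rewrite ltnNge mn.
rewrite (eq_big_nat _ _ (F2 := fun=> 1%E)) => [|n /andP[_ ->]//].
by rewrite sumEFin sumr_const_nat subn0.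
Qed.

Lemma nneseries1 : (\sum_(0 <= n <oo) (1 : \bar R) = +oo)%E.
Proof.
apply: eq_infty => a; apply: le_trans (nneseries_lim_ge (Num.bound `|a|) _) => //.
rewrite sumEFin sumr_const_nat subn0 lee_fin (le_trans (ler_norm a))// ltW//.
exact: archi_boundP.
Qed.

Lemma termination_time_first (w : run) m :
  w m <= 0 -> (forall n, w n <= 0 -> (m <= n)%N) ->
  termination_time w = m%:R%:E :> \bar R.
Proof.
move=> wm wmin; apply/eqP; rewrite eq_le; apply/andP; split.
  by apply: ereal_inf_lbound; exists m.
by apply: le_ereal_inf_tmp => _ [n /= /wmin mn <-]; rewrite lee_fin ler_nat.
Qed.

Lemma termination_timeE (w : run) :
  termination_time w = (\sum_(0 <= n <oo) (\1_(alive 0 n) w)%:E)%E :> \bar R.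
Proof.
have [[n wn]|wpos] := pselect (exists n, w n <= 0); last first.
  have aliveT n : \1_(alive 0 n) w = 1 :> R.
    rewrite indicE mem_set// => i _.
    by rewrite ltNge; apply/negP => wi; apply: wpos; exists i.
  under eq_eseriesr => n _ do rewrite aliveT.
  rewrite nneseries1 /termination_time.
  rewrite (_ : [set n | _] = set0) ?image_set0 ?ereal_inf0//.
  by apply/seteqP; split => // n /= wn; apply: wpos; exists n.
have [m wm wmin] := ex_minnP (ex_intro (fun n => w n <= 0) n wn).
rewrite (termination_time_first wm wmin) -nneseries_ltn.
apply: eq_eseriesr => i _; rewrite indicE; congr ((nat_of_bool _)%:R%:E).
apply/idP/idP => [im|]; first rewrite mem_set// => j /= ji.
  by rewrite ltNge; apply/negP => /wmin; lia.
by rewrite inE ltnNge => iw; apply/negP => mi; have := iw m mi; rewrite ltNge wm.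
Qed.

End termination_time.

Section survival.
Context {R : realType} (P : rw_program R).
Local Notation N := (rw_k P + rw_m P).+1.
Local Notation step i := ((i : nat)%:Z - (rw_k P)%:Z).
Implicit Types (f g : int -> R) (x y : int).

Lemma rw_p_step_ge0 (i : 'I_N) : 0 <= rw_p P (step i).
Proof. by apply: rw_p_ge0; have := ltn_ord i; lia. Qed.

Lemma rw_p'_eq0 : rw_p' P <= 0 -> rw_p' P = 0.
Proof. by move=> p'0; apply/eqP; rewrite eq_le p'0 rw_p'_ge0. Qed.

Lemma sum_rw_p : \sum_(i < N) rw_p P (step i) = 1 - rw_p' P.
Proof. by rewrite -(rw_sum1 P) addrK. Qed.

Definition jump_mean f x : R := \sum_(i < N) rw_p P (step i) * f (x + step i).

Lemma ler_jump_mean f g x :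
  (forall y, x - (rw_k P)%:Z <= y <= x + (rw_m P)%:Z -> f y <= g y) ->
  jump_mean f x <= jump_mean g x.
Proof.
move=> fg; apply: ler_sum => i _; rewrite ler_wpM2l ?rw_p_step_ge0// fg//.
by have := ltn_ord i; lia.
Qed.

Lemma jump_meanD f g x :
  jump_mean (fun y => f y + g y) x = jump_mean f x + jump_mean g x.
Proof. by rewrite -big_split; apply: eq_bigr => i _; rewrite mulrDr. Qed.

Lemma jump_meanZ a f x : jump_mean (fun y => a * f y) x = a * jump_mean f x.
Proof. by rewrite mulr_sumr; apply: eq_bigr => i _; rewrite mulrCA. Qed.

Lemma jump_mean_sum n (F : 'I_n -> int -> R) x :
  jump_mean (fun y => \sum_(i < n) F i y) x = \sum_(i < n) jump_mean (F i) x.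
Proof. by rewrite exchange_big; apply: eq_bigr => i _; rewrite mulr_sumr. Qed.

Lemma jump_mean_cst a x : jump_mean (fun=> a) x = (1 - rw_p' P) * a.
Proof. by rewrite /jump_mean -mulr_suml sum_rw_p. Qed.

Lemma jump_mean_intr x :
  jump_mean (fun y => y%:~R) x = (1 - rw_p' P) * x%:~R + rw_drift P.
Proof.
rewrite /jump_mean; under eq_bigr => i _ do rewrite intrD mulrDr.
rewrite big_split /= -mulr_suml sum_rw_p; congr (_ + _).
by apply: eq_bigr => i _; rewrite mulrC.
Qed.

Lemma cvg_jump_mean (u : nat -> int -> R) f x :
  (forall y, u n y @[n --> \oo] --> f y) ->
  jump_mean (u n) x @[n --> \oo] --> jump_mean f x.
Proof.
move=> uf; apply: cvg_big => [|i _]; first exact: add_continuous.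
by apply: cvgM; [exact: cvg_cst|exact: uf].
Qed.

Fixpoint survival (n : nat) (x : int) : R :=
  if 0 < x then if n is n'.+1 then jump_mean (survival n') x else 1 else 0.

Lemma survival_le0 n x : x <= 0 -> survival n x = 0.
Proof. by case: n => [|n] /=; rewrite ltNge => ->. Qed.

Lemma survivalS n x : 0 < x -> survival n.+1 x = jump_mean (survival n) x.
Proof. by move=> /= ->. Qed.

Lemma survival_ge0 n x : 0 <= survival n x.
Proof.
elim: n x => [|n IHn] x /=; case: ifP => // _.
by apply: sumr_ge0 => i _; rewrite mulr_ge0 ?rw_p_step_ge0.
Qed.

Definition successors x : seq int :=
  undup (rw_d P :: [seq x + step (nat_of_ord i) | i <- enum 'I_N]).

Lemma sum_rw_trans f x : 0 < x ->
  \sum_(z <- successors x) rw_trans P x z * f z =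
  jump_mean f x + rw_p' P * f (rw_d P).
Proof.
move=> x0; have pick a (p : R) : a \in successors x ->
    \sum_(z <- successors x) (if z == a then p else 0) * f z = p * f a.
  move=> ax; rewrite (bigD1_seq a) ?undup_uniq//= eqxx big1 ?addr0// => z /negbTE ->.
  by rewrite mul0r.
under eq_bigr => z _ do rewrite /rw_trans x0 mulrDl mulr_suml.
rewrite big_split /= pick ?mem_undup ?mem_head//; congr (_ + _).
rewrite exchange_big /=; apply: eq_bigr => i _; rewrite pick//.
by rewrite mem_undup inE; apply/orP; right; apply/mapP; exists i; rewrite ?mem_enum.
Qed.

Section run_measure.
Variables (x : int) (Q : probability run R).
Hypothesis Q_run : is_run_measure P x Q.

Lemma run_measure_cylinder_extend l (s : nat -> int) z :
  Q (cylinder l.+1 (extend_path l s z)) = (Q (cylinder l s) * (rw_trans P (s l) z)%:E)%E.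
Proof.
rewrite [LHS]Q_run [in RHS]Q_run /extend_path leq0n.
case: ifP => _; last by rewrite mul0e.
rewrite big_ord_recr /= leqnn ltnn EFinM; congr (_%:E * _)%E.
by apply: eq_bigr => i _; rewrite (ltnW (ltn_ord i)) ltn_ord.
Qed.

Lemma run_measure_first_step l (s : nat -> int) (A : set run) : measurable A -> 0 < s l ->
  Q (cylinder l s `&` A) =
  (\sum_(z <- successors (s l)) Q (cylinder l.+1 (extend_path l s z) `&` A))%E.
Proof.
move=> mA sl; apply: measure_setI_partition => //.
- exact: measurable_cylinder.
- by rewrite [X in (X < _)%E]Q_run ltry.
- by move=> z; exact: measurable_cylinder.
- exact: undup_uniq.
- move=> a b _ _ [w [wa wb]].
  by rewrite !cylinder_extend in wa wb; rewrite -wa.2 -wb.2.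
- by move=> z; rewrite cylinder_extend; exact: subIsetl.
have [q Qs] : exists q, Q (cylinder l s) = q%:E by rewrite Q_run; eexists.
apply: (@etrans _ _ (\sum_(z <- successors (s l)) (q * rw_trans P (s l) z)%:E)%E).
  rewrite sumEFin -mulr_sumr; under eq_bigr => z _ do rewrite -[rw_trans _ _ _]mulr1.
  by rewrite (sum_rw_trans (fun=> 1))// jump_mean_cst !mulr1 subrK mulr1; exact: Qs.
by apply: eq_bigr => z _; rewrite EFinM -Qs -run_measure_cylinder_extend.
Qed.

Lemma run_measure_alive_from l n (s : nat -> int) :
  Q (cylinder l s `&` alive l (l + n)) = (Q (cylinder l s) * (survival n (s l))%:E)%E.
Proof.
elim: n l s => [|n IHn] l s; (have [sl|sl] := ltP 0 (s l);
    last by rewrite cylinder_alive_eq0 ?leq_addr// survival_le0// measure0 mule0).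
  rewrite /= sl mule1; congr (Q _); apply/setIidl => w ws i.
  rewrite addn0 => il; have -> : i = l by lia.
  by rewrite ws.
have next z : Q (cylinder l.+1 (extend_path l s z) `&` alive l (l + n.+1)) =
    (Q (cylinder l s) * (rw_trans P (s l) z * survival n z)%:E)%E.
  rewrite EFinM muleA -run_measure_cylinder_extend.
  have := IHn l.+1 (extend_path l s z); rewrite {3}/extend_path ltnn => <-.
  congr (Q _); apply/seteqP; split => w [ws wpos]; split=> // i il.
    by apply: wpos; lia.
  have [->|] := eqVneq i l; last by move=> ?; apply: wpos; lia.
  by rewrite ws// /extend_path leqnn.
rewrite survivalS// (run_measure_first_step (measurable_alive _ _) sl).
rewrite (eq_bigr _ (fun z _ => next z)).
have [q ->] : exists q, Q (cylinder l s) = q%:E by rewrite Q_run; eexists.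
under eq_bigr => z _ do rewrite -EFinM.
by rewrite sumEFin -mulr_sumr sum_rw_trans// survival_le0 ?rw_d_le0// mulr0 addr0.
Qed.

Lemma run_measure_alive n : Q (alive 0 n) = (survival n x)%:E.
Proof.
have Q1 : Q (cylinder 0 (fun=> x)) = 1%E by rewrite Q_run eqxx big_ord0.
rewrite -[survival n x]mul1r EFinM -Q1 -run_measure_alive_from.
rewrite -[alive 0 n in LHS]setTI.
rewrite (@measure_setI_partition _ _ _ Q _ [:: tt] _ _ (fun=> cylinder 0 (fun=> x)))//.
- by rewrite big_seq1.
- by rewrite [X in (X < _)%E]probability_setT ltry.
- exact: measurable_alive.
- by move=> _; exact: measurable_cylinder.
- by move=> [] [].
- by rewrite big_seq1; exact: etrans (probability_setT Q) (esym Q1).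
Qed.

End run_measure.

Lemma expected_runtime_series x : (expected_runtime P x < +oo)%E ->
  expected_runtime P x = (\sum_(0 <= n <oo) (survival n x)%:E)%E.
Proof.
rewrite /expected_runtime; case: ifP => // _ _.
under eq_integral => w _ do rewrite termination_timeE.
rewrite integral_nneseries//.
- apply: eq_eseriesr => n _; rewrite integral_indic ?setIT//.
    exact: run_measure_alive (run_measureP P x) n.
  exact: measurable_alive.
- by move=> n; apply/measurable_EFinP; apply: measurable_indic; exact: measurable_alive.
Qed.

Section runtime.
Hypothesis hP : positively_ast P.

Definition runtime (x : int) : R := fine (expected_runtime P x).

Lemma expected_runtimeE x : expected_runtime P x = (runtime x)%:E.
Proof.
rewrite /runtime fineK// ge0_fin_numE ?hP// expected_runtime_series ?hP//.
by apply: nneseries_ge0 => n _ _; rewrite lee_fin survival_ge0.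
Qed.

Lemma cvg_survival_series x : series (survival^~ x) @ \oo --> runtime x.
Proof.
have seriesE := expected_runtime_series (hP x).
have fin : (\sum_(0 <= n <oo) (survival n x)%:E < +oo)%E by rewrite -seriesE hP.
have cv := nnseries_is_cvg (survival_ge0 ^~ x) fin.
rewrite /runtime seriesE (_ : limn _ = (limn (series (survival^~ x)))%:E)//.
rewrite -EFin_lim//; congr (limn _); apply/funext => n /=.
by rewrite /series /= sumEFin.
Qed.

Lemma ler_survival_series x n : series (survival^~ x) n <= runtime x.
Proof.
rewrite -(cvg_lim _ (@cvg_survival_series x))//; apply: nondecreasing_cvgn_le.
  by apply: nondecreasing_series => i _ _; exact: survival_ge0.
exact: cvgP (@cvg_survival_series x).
Qed.

Lemma runtime_ge0 x : 0 <= runtime x.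
Proof. by have := ler_survival_series x 0; rewrite /series /= big_geq. Qed.

Lemma runtime_le x K : (forall n, series (survival^~ x) n <= K) -> runtime x <= K.
Proof. by move=> sK; apply: cvgr_to_le (@cvg_survival_series x) _; exact: nearW. Qed.

Lemma runtime_le0 x : x <= 0 -> runtime x = 0.
Proof.
move=> x0; apply/eqP; rewrite eq_le runtime_ge0 andbT; apply: runtime_le => n.
by rewrite /series /= big1// => i _; rewrite survival_le0.
Qed.

Lemma cvg_survival0 x : survival n x @[n --> \oo] --> 0.
Proof. by apply: cvg_series_cvg_0; exact: cvgP (@cvg_survival_series x). Qed.

Lemma survival_seriesS n x : 0 < x ->
  series (survival^~ x) n.+1 = 1 + jump_mean (fun y => series (survival^~ y) n) x.
Proof.
move=> x0; rewrite /series /= big_nat_recl//= x0; congr (_ + _).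
rewrite big_mkord -jump_mean_sum; apply: eq_bigr => i _; congr (_ * _).
by rewrite big_mkord.
Qed.

Lemma runtime_rec x : 0 < x -> runtime x = 1 + jump_mean runtime x.
Proof.
move=> x0; apply: (cvg_unique _ (@cvg_survival_series x)) => //.
rewrite /= -cvg_shiftS; under eq_fun => n do rewrite /= survival_seriesS//.
by apply: cvgD; [exact: cvg_cst|exact: cvg_jump_mean cvg_survival_series].
Qed.

Lemma subharmonic_le0 f (M : R) :
  (forall x, x <= 0 -> f x <= 0) -> (forall x, 0 < x -> f x <= jump_mean f x) ->
  (forall x, f x <= M) -> forall x, f x <= 0.
Proof.
move=> f0 fsub fM x; have M0 : 0 <= Num.max M 0 by rewrite le_max lexx orbT.
have fsurv n y : f y <= Num.max M 0 * survival n y.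
  elim: n y => [|n IHn] y; have [y0|y0] := leP y 0.
  - by rewrite survival_le0// mulr0 f0.
  - by rewrite /= y0 mulr1 le_max fM.
  - by rewrite survival_le0// mulr0 f0.
  - by rewrite survivalS// -jump_meanZ (le_trans (fsub y y0))// ler_jump_mean.
rewrite -(mulr0 (Num.max M 0)).
apply: (@ler_cvg_to _ \oo _ _ (fun=> f x) (fun n => Num.max M 0 * survival n x)).
- exact: cvg_cst.
- by apply: cvgM; [exact: cvg_cst|exact: cvg_survival0].
- by apply: nearW => n; exact: fsurv.
Qed.

Lemma runtime_le_supersolution f :
  (forall x, - (rw_k P)%:Z <= x -> 0 <= f x) ->
  (forall x, 0 < x -> 1 + jump_mean f x <= f x) ->
  forall x, - (rw_k P)%:Z <= x -> runtime x <= f x.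
Proof.
move=> f0 fsup x xk; apply: runtime_le => n; elim: n x xk => [|n IHn] x xk.
  by rewrite /series /= big_geq// f0.
have [x0|x0] := ltP 0 x; last first.
  by rewrite /series /= big1 ?f0// => i _; rewrite survival_le0.
rewrite survival_seriesS// (le_trans _ (fsup x x0))// lerD2l.
by apply: ler_jump_mean => y yx; apply: IHn; lia.
Qed.

(* With nonnegative drift, the positive part of the walk killed at 0 is a
   submartingale, and after [n] steps it is at most [x + n * rw_m P]. *)
Lemma survival_ge_of_drift_ge0 n x (M : R) : rw_p' P = 0 -> 0 <= rw_drift P ->
  0 <= M -> x%:~R + (n * rw_m P)%:R <= M -> x%:~R <= M * survival n x.
Proof.
move=> p'0 drift0 M0; elim: n x => [|n IHn] x xM; have [x0|x0] := leP x 0.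
- by rewrite survival_le0// mulr0 lerz0.
- by rewrite /= x0 mulr1; move: xM; rewrite mul0n addr0.
- by rewrite survival_le0// mulr0 lerz0.
rewrite survivalS// -jump_meanZ (@le_trans _ _ (jump_mean (fun y => y%:~R) x))//.
  by rewrite jump_mean_intr p'0 subr0 mul1r lerDl.
apply: ler_jump_mean => y /andP[_ yx]; apply: IHn; rewrite (le_trans _ xM)//.
by rewrite !pmulrn -!intrD ler_int; lia.
Qed.

Lemma rw_drift_lt0 : rw_p' P = 0 -> rw_drift P < 0.
Proof.
move=> p'0; rewrite ltNge; apply/negP => drift0.
have m0 : 0 <= (rw_m P)%:R :> R by [].
have lb n : harmonic n <= (1 + (rw_m P)%:R) * survival n 1.
  rewrite /harmonic /= -[leLHS]mul1r ler_pdivrMr ?ltr0n// mulrAC.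
  apply: (@survival_ge_of_drift_ge0 n 1) => //.
  rewrite natrM -(natr1 n); have n0 : 0 <= n%:R :> R by [].
  by rewrite (_ : 1%:~R = 1 :> R)//; lra.
apply: (@dvg_harmonic R); apply: (series_le_cvg _ _ lb).
- exact: harmonic_ge0.
- by move=> n; rewrite mulr_ge0 ?survival_ge0// addr_ge0.
- have cv : cvgn (series (survival^~ 1)) by exact: cvgP (@cvg_survival_series 1).
  exact: is_cvg_seriesZ cv.
Qed.

Lemma rw_k_gt0 : rw_p' P = 0 -> (0 < rw_k P)%N.
Proof.
move=> /rw_drift_lt0; rewrite lt0n; apply: contraTneq => k0; rewrite -leNgt.
apply: sumr_ge0 => i _; rewrite mulr_ge0 ?rw_p_step_ge0// ler0z.
by lia.
Qed.

Lemma rw_C_affine : exists a b : R,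
  [/\ 0 <= a, 0 <= b & forall x, rw_C P x = a + b * x%:~R].
Proof.
have [p'0|p'0] := ltP 0 (rw_p' P).
  exists (1 / rw_p' P), 0; split=> // [|x]; first by rewrite divr_ge0// ltW.
  by rewrite /rw_C p'0 mul0r addr0.
have {}p'0 := rw_p'_eq0 p'0.
exists 0, (- (1 / rw_drift P)); split=> // [|x]; last by rewrite /rw_C p'0 ltxx add0r.
by rewrite -mulrN -invrN divr_ge0// oppr_ge0 ltW// rw_drift_lt0.
Qed.

Lemma rw_C_rec x : rw_C P x = 1 + jump_mean (rw_C P) x.
Proof.
rewrite /rw_C; case: ltP => p'0.
  by rewrite jump_mean_cst; field; rewrite gt_eqF.
have {}p'0 := rw_p'_eq0 p'0.
rewrite jump_meanZ jump_mean_intr p'0.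
by field; rewrite lt_eqF// rw_drift_lt0.
Qed.

Definition runtime_excess x : R := runtime x - rw_C P x.

Lemma runtime_excess_harmonic x : 0 < x -> runtime_excess x = jump_mean runtime_excess x.
Proof.
move=> x0; apply: (@addIr _ (rw_C P x)); rewrite subrK runtime_rec// [in RHS]rw_C_rec.
rewrite addrCA -jump_meanD; congr (1 + _); apply: eq_bigr => i _.
by rewrite subrK.
Qed.

Lemma runtime_excess_linear : exists K : R, forall n : nat,
  `|runtime_excess (- (rw_k P)%:Z + 1 + n%:Z)| <= K * n.+1%:R.
Proof.
have [a [b [a0 b0 CE]]] := rw_C_affine; pose k := (rw_k P)%:R : R.
exists (a + b * (1 + k)) => n; set x := - _ + _ + _.
have runtime_le_C : runtime x <= rw_C P x + b * k.
  apply: (@runtime_le_supersolution (fun y => rw_C P y + b * k)); last by rewrite /x; lia.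
    move=> y yk; rewrite CE -addrA -mulrDr addr_ge0// mulr_ge0//.
    by rewrite /k pmulrn -intrD ler0z; lia.
  move=> y y0; rewrite jump_meanD jump_mean_cst addrA -rw_C_rec lerD2l.
  by rewrite ler_piMl ?mulr_ge0// gerBl rw_p'_ge0.
have xE : x%:~R = n.+1%:R - k.
  by rewrite /k !pmulrn -intrB; congr (_%:~R); rewrite /x; lia.
have n1 : 1 <= n.+1%:R :> R by rewrite ler1n.
have bk0 : 0 <= b * k by rewrite mulr_ge0.
have an : a <= a * n.+1%:R by rewrite ler_peMr.
have bkn : b * k <= b * k * n.+1%:R by rewrite ler_peMr.
have bn : 0 <= b * n.+1%:R by rewrite mulr_ge0.
rewrite ler_norml /runtime_excess; move: runtime_le_C (runtime_ge0 x); rewrite CE xE.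
by move=> rC r0; apply/andP; split; lra.
Qed.

End runtime.
End survival.

(** * The characteristic polynomial *)

Lemma mup_leq1 (F : fieldType) (p : {poly F}) z : ~~ root p^`() z -> (mup z p <= 1)%N.
Proof.
move=> p'z; rewrite mup_leq; last by apply: contraNneq p'z => ->; rewrite deriv0 root0.
apply: contra p'z => /dvdpP[q ->].
rewrite expr2 !derivM rootE !(hornerXsubC, hornerD, hornerM) subrr.
by rewrite !(mul0r, mulr0, addr0).
Qed.

Lemma complex_archimedean (R : archiRcfType) : Num.archimedean_axiom R[i].
Proof.
move=> z; exists (Num.bound (complex.Re `|z|)).
rewrite -(RRe_real (normr_real z)) -(rmorph_nat (real_complex R)) ltcR.
by apply: archi_boundP; rewrite -ler0c RRe_real// normr_real.
Qed.

HB.instance Definition _ (R : archiRcfType) :=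
  Num.NumDomain_bounded_isArchimedean.Build R[i] (@complex_archimedean R).

Lemma normr_normc (R : rcfType) (z : R[i]) : `|z| = (Normc.normc z)%:C.
Proof. by []. Qed.

Lemma normr_real_complex (R : rcfType) (r : R) : `|r%:C| = `|r|%:C.
Proof. by rewrite normc_def /= expr0n addr0 sqrtr_sqr. Qed.

Section characteristic_polynomial.
Context {R : realType} (P : rw_program R).
Local Notation N := (rw_k P + rw_m P).+1.
Local Notation step i := ((i : nat)%:Z - (rw_k P)%:Z).
Local Notation chi := (rw_charpoly P).

Lemma rw_charpolyE : chi = \poly_(i < N) (rw_p P (step i))%:C - 'X^(rw_k P).
Proof. by rewrite /rw_charpoly poly_def. Qed.

Lemma shift_act_rw_charpoly (g : int -> R[i]) x : shift_act chi g (x - (rw_k P)%:Z) =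
  \sum_(i < N) (rw_p P (step i))%:C * g (x + step i) - g x.
Proof.
have kN : (rw_k P < N)%N by rewrite ltnS leq_addr.
rewrite (@shift_act_widen _ N); last first.
  rewrite rw_charpolyE (leq_trans (size_polyD _ _))// geq_max size_poly size_polyN.
  by rewrite size_polyXn.
under eq_bigr => i _ do
  rewrite rw_charpolyE coefB coef_poly ltn_ord coefXn mulrBl -addrA (addrC (- _)).
rewrite sumrB; congr (_ - _).
rewrite (bigD1 (Ordinal kN))//= eqxx mul1r subrr addr0 big1 ?addr0// => i.
by rewrite -val_eqE /= => /negbTE ->; rewrite mul0r.
Qed.

Lemma shift_act_rw_charpoly_real (f : int -> R) x :
  shift_act chi (fun y => (f y)%:C) (x - (rw_k P)%:Z) = (jump_mean P f x - f x)%:C.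
Proof.
rewrite shift_act_rw_charpoly rmorphB rmorph_sum; congr (_ - _).
by apply: eq_bigr => i _; rewrite rmorphM.
Qed.

Lemma normc_subharmonic (g : int -> R[i]) x : shift_act chi g (x - (rw_k P)%:Z) = 0 ->
  Normc.normc (g x) <= jump_mean P (fun y => Normc.normc (g y)) x.
Proof.
rewrite shift_act_rw_charpoly => /eqP; rewrite subr_eq0 => /eqP gx.
rewrite -lecR -normr_normc -gx (le_trans (ler_norm_sum _ _ _))// rmorph_sum.
apply: ler_sum => i _.
by rewrite normrM normr_real_complex (ger0_norm (rw_p_step_ge0 i)) rmorphM.
Qed.

Lemma horner_rw_charpoly z : chi.[z] =
  \sum_(i < N) (rw_p P (step i))%:C * z ^+ i - z ^+ rw_k P.
Proof. by rewrite rw_charpolyE hornerD hornerN hornerXn horner_poly. Qed.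

Lemma horner_deriv_rw_charpoly z : z * chi^`().[z] =
  \sum_(i < N) (rw_p P (step i))%:C * z ^+ i *+ i - z ^+ rw_k P *+ rw_k P.
Proof.
have zX n : z * (z ^+ n.-1 *+ n) = z ^+ n *+ n.
  by case: n => [|n]; rewrite ?mulr0n ?mulr0// mulrnAr -exprS.
rewrite /rw_charpoly derivB derivXn raddf_sum hornerD hornerN horner_sum mulrBr.
rewrite hornerMn hornerXn zX mulr_sumr; congr (_ - _); apply: eq_bigr => i _.
by rewrite /= derivZ derivXn hornerZ hornerMn hornerXn mulrCA zX mulrnAr.
Qed.

(* The equality case of the triangle inequality in [chi.[z] = 0]. *)
Lemma unit_root_aligned z : root chi z -> `|z| = 1 -> rw_p' P = 0 /\
  forall i : 'I_N, (rw_p P (step i))%:C * z ^+ i = (rw_p P (step i))%:C * z ^+ rw_k P.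
Proof.
rewrite rootE horner_rw_charpoly subr_eq0 => /eqP rz z1.
have zk0 : z ^+ rw_k P != 0 by rewrite expf_neq0// -normr_gt0 z1.
pose term (i : 'I_N) := (rw_p P (step i))%:C * z ^+ i / z ^+ rw_k P.
have norm_term i : `|term i| = (rw_p P (step i))%:C.
  rewrite normrM normfV normrM !normrX z1 !expr1n invr1 !mulr1.
  by rewrite normr_real_complex ger0_norm// rw_p_step_ge0.
have sum_term : \sum_i term i = 1 by rewrite -mulr_suml rz divff.
have sum_p : \sum_(i < N) (rw_p P (step i))%:C = (1 - rw_p' P)%:C.
  by rewrite -rmorph_sum sum_rw_p.
have p'0 : rw_p' P = 0.
  apply: rw_p'_eq0; have := ler_norm_sum (index_enum 'I_N) term xpredT.
  rewrite sum_term normr1 (eq_bigr _ (fun i _ => norm_term i)) sum_p lecR; lra.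
split=> // i; rewrite -[LHS](divfK zk0); congr (_ * _).
apply: (@normC_sum_upper _ _ xpredT term (fun i => (rw_p P (step i))%:C)) => // [j _|].
  by rewrite norm_term.
by rewrite sum_p p'0 subr0; exact: sum_term.
Qed.

Hypothesis hP : positively_ast P.

Lemma rw_charpoly_root0 : ~~ root chi 0.
Proof.
rewrite rootE horner_rw_charpoly big_ord_recl /= expr0 mulr1 sub0r.
rewrite big1 ?addr0 => [|i _]; last by rewrite expr0n mulr0.
have [k0|k0] := posnP (rw_k P); last first.
  rewrite expr0n gtn_eqF// subr0; apply/eqP => /complexI p0.
  by have := rw_pk_gt0 k0; rewrite p0 ltxx.
rewrite (_ : 0 ^+ rw_k P = 1) ?k0 ?expr0// -k0 subr_eq0; apply/eqP => /complexI p1.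
have p'0 : rw_p' P = 0.
  apply: rw_p'_eq0; have := rw_sum1 P; rewrite big_ord_recl /= sub0r p1 => h.
  suff : 0 <= \sum_(i < rw_k P + rw_m P) rw_p P (step (bump 0 i)) by lra.
  by apply: sumr_ge0 => i _; exact: (rw_p_step_ge0 (lift ord0 i)).
by have := rw_k_gt0 hP p'0; rewrite k0.
Qed.

Lemma rw_charpoly_neq0 : chi != 0.
Proof. by apply: contraNneq rw_charpoly_root0 => ->; rewrite root0. Qed.

Lemma unit_root_simple z : `|z| = 1 -> (mup z chi <= 1)%N.
Proof.
move=> z1; have [rz|/mupNroot-> //] := boolP (root chi z).
have z0 : z != 0 by rewrite -normr_gt0 z1.
have [p'0 aligned] := unit_root_aligned rz z1.
suff zchi' : z * chi^`().[z] = (rw_drift P)%:C * z ^+ rw_k P.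
  apply/mup_leq1; rewrite rootE -(mulrI_eq0 _ (mulfI z0)) zchi'.
  rewrite mulf_neq0 ?expf_neq0//.
  by rewrite (inj_eq (@complexI R) _ 0) lt_eqF// rw_drift_lt0.
rewrite horner_deriv_rw_charpoly; under eq_bigr => i _ do rewrite aligned -mulrnAl.
rewrite -mulr_suml -[_ *+ rw_k P]mulr_natl -mulrBl; congr (_ * _).
rewrite /rw_drift.
under [in RHS]eq_bigr => i _ do rewrite intrB mulrBl -!pmulrn !mulr_natl.
rewrite sumrB rmorphB rmorph_sum /= -!rmorphMn; congr (_ - _).
  by apply: eq_bigr => i _; rewrite rmorphMn.
by rewrite sumrMnl sum_rw_p p'0 subr0.
Qed.

End characteristic_polynomial.

Section closed_form.
Context {R : realType} (P : rw_program R) (c : nat) (lam : 'I_c -> R[i]).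
Local Notation chi := (rw_charpoly P).
Implicit Types (Q : 'I_c -> {poly R[i]}) (b : 'I_c -> nat -> R[i]) (v : 'I_c -> nat).

Definition coef_family v b (j : 'I_c) : {poly R[i]} :=
  if `|lam j| <= 1 then \poly_(u < v j) b j u else 0.

Lemma rw_ansatzE v b x :
  rw_ansatz P lam v b x = (rw_C P x)%:C + exppoly lam (coef_family v b) x.
Proof.
rewrite /rw_ansatz /exppoly big_mkcond; congr (_ + _); apply: eq_bigr => j _.
rewrite /expseq /coef_family; case: ifP => _; last by rewrite horner0 mulr0.
by rewrite horner_poly mulr_sumr; apply: eq_bigr => u _; rewrite mulrCA mulrA.
Qed.

Lemma coef_coef_family v b j u : `|lam j| <= 1 -> (u < v j)%N ->
  (coef_family v b j)`_u = b j u.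
Proof. by move=> lj uv; rewrite /coef_family lj coef_poly uv. Qed.

Section multiplicities.
Variable v : 'I_c -> nat.
Hypothesis v_mult : forall j, v j = mup (lam j) chi.

Lemma stable_coef_family b : stable_family chi lam (coef_family v b).
Proof.
move=> j; rewrite /coef_family /stable_mup -v_mult.
by case: ifP => _; rewrite ?size_poly0// size_poly.
Qed.

Lemma coef_familyK Q : stable_family chi lam Q -> coef_family v (fun j u => (Q j)`_u) = Q.
Proof.
move=> sQ; apply/funext => j; have := sQ j; rewrite /coef_family /stable_mup -v_mult.
case: ifP => _ Qj; last by apply/esym/eqP; rewrite -size_poly_eq0 -leqn0.
apply/polyP => u; rewrite coef_poly; case: ltnP => // vu.
by rewrite nth_default// (leq_trans Qj).
Qed.

End multiplicities.

Hypothesis hP : positively_ast P.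
Hypothesis lam_inj : injective lam.
Hypothesis lam_roots : forall z, root chi z <-> exists j, z = lam j.

Let chi_neq0 := rw_charpoly_neq0 hP.

Lemma rw_charpoly_roots_neq0 j : lam j != 0.
Proof.
apply: contraNneq (rw_charpoly_root0 hP) => <-.
by apply/lam_roots; exists j.
Qed.

Lemma stable_exppoly_eq0 Q : stable_family chi lam Q ->
  (forall x, - (rw_k P)%:Z + 1 <= x <= 0 -> exppoly lam Q x = 0) -> forall j, Q j = 0.
Proof.
move=> sQ Q0.
have [M MP] := stable_exppoly_bounded rw_charpoly_roots_neq0 1 (unit_root_simple hP) sQ.
pose g x := if 0 < x then exppoly lam Q x else 0.
have gE x : - (rw_k P)%:Z + 1 <= x -> exppoly lam Q x = g x.
  by move=> xk; rewrite /g; case: ltP => // x0; rewrite Q0// xk x0.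
have g0 x : Normc.normc (g x) <= 0.
  apply: (@subharmonic_le0 _ P hP (fun y => Normc.normc (g y)) (complex.Re M)) => {x} x.
  - by rewrite /g; case: ltP => // _ _; rewrite Normc.normc0.
  - move=> x0; apply: normc_subharmonic.
    rewrite -[RHS](shift_act_stable_eq0 chi_neq0 rw_charpoly_roots_neq0
      (x - (rw_k P)%:Z) sQ).
    by apply: eq_bigr => i _; rewrite gE//; lia.
  - have Mge0 : 0 <= M by rewrite (le_trans _ (MP 0%N)).
    have MR : (complex.Re M)%:C = M by rewrite RRe_real// ger0_real.
    rewrite -lecR MR -normr_normc /g; case: ifP => [x0|_]; last by rewrite normr0.
    by have -> : x = 1 + `|x - 1|%N%:Z by lia.
apply: (exppoly_eq0 rw_charpoly_roots_neq0 (x0 := - (rw_k P)%:Z + 1) lam_inj) => x /gE ->.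
by apply/eqP; rewrite -normr_le0 normr_normc lecR.
Qed.

Lemma stable_exppoly_inj Q1 Q2 :
  stable_family chi lam Q1 -> stable_family chi lam Q2 ->
  (forall x, - (rw_k P)%:Z + 1 <= x <= 0 -> exppoly lam Q1 x = exppoly lam Q2 x) ->
  Q1 = Q2.
Proof.
move=> sQ1 sQ2 Q12; apply/funext => j; apply/eqP; rewrite -subr_eq0; apply/eqP.
apply: (stable_exppoly_eq0 (stable_familyB sQ1 sQ2)) => x xk.
by rewrite exppolyB Q12// subrr.
Qed.

Lemma runtime_exppoly : exists2 Q, stable_family chi lam Q &
  forall x, - (rw_k P)%:Z + 1 <= x ->
    (runtime P x)%:C = (rw_C P x)%:C + exppoly lam Q x.
Proof.
have [K excess_le] := runtime_excess_linear hP.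
pose f x := (runtime_excess P x)%:C.
have [||x xk|Q sQ fQ] := @subexponential_recurrence _ chi _ lam chi_neq0
    rw_charpoly_roots_neq0 (- (rw_k P)%:Z + 1) f.
- by move=> z /lam_roots[j ->]; exact: codom_f.
- apply: (@linear_subexponential _ _ _ K%:C) => n.
  by rewrite normr_real_complex -(rmorph_nat (real_complex R)) -rmorphM lecR.
- rewrite -[x](addrK (rw_k P)%:Z) shift_act_rw_charpoly_real.
  by rewrite -runtime_excess_harmonic ?subrr//; lia.
by exists Q => // x xk; rewrite -fQ// -rmorphD /runtime_excess addrC subrK.
Qed.

Lemma runtime_rw_k0 x : rw_k P = 0%N -> 0 < x -> runtime P x = 1 / rw_p' P.
Proof.
move=> k0 x0; have p'0 : 0 < rw_p' P.
  by rewrite lt_def rw_p'_ge0 andbT; apply/eqP => /(rw_k_gt0 hP); rewrite k0.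
have [Q sQ runtimeE] := runtime_exppoly.
have Q0 : forall j, Q j = 0 by apply: stable_exppoly_eq0 => // y; rewrite k0; lia.
apply: complexI; rewrite runtimeE ?k0; last by lia.
by rewrite /exppoly big1 ?addr0 /rw_C ?p'0// => j _; rewrite Q0 /expseq horner0 mulr0.
Qed.

End closed_form.

Theorem theorem29 (R : realType) (P : rw_program R) (hP : positively_ast P)
    (c : nat) (lam : 'I_c -> R[i]) (v : 'I_c -> nat)
    (lam_inj : injective lam)
    (lam_roots : forall z : R[i],
       root (rw_charpoly P) z <-> exists j : 'I_c, z = lam j)
    (v_mult : forall j : 'I_c, v j = mup (lam j) (rw_charpoly P)) :
  [/\ (forall x : int, x <= 0 -> expected_runtime P x = 0%E),
      (exists a : 'I_c -> nat -> R[i],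
        let solves (b : 'I_c -> nat -> R[i]) : Prop :=
          forall x : int, - (rw_k P)%:Z + 1 <= x <= 0 ->
            0 = rw_ansatz P lam v b x in
        [/\ solves a,
            (forall b : 'I_c -> nat -> R[i], solves b ->
               forall (j : 'I_c) (u : nat), `|lam j| <= 1 -> (u < v j)%N ->
                 b j u = a j u) &
            (forall x : int, 0 < x ->
               exists2 r : R, expected_runtime P x = r%:E &
                              r%:C = rw_ansatz P lam v a x)]) &
      (rw_k P = 0%N -> forall x : int, 0 < x ->
         expected_runtime P x = (1 / rw_p' P)%:E)].
Proof.
have [Q sQ runtimeE] := runtime_exppoly hP lam_roots.
split=> [x x0||k0 x x0].
- by rewrite (expected_runtimeE hP) runtime_le0.
- pose a j u := (Q j)`_u; exists a => solves.
  have aE x : rw_ansatz P lam v a x = (rw_C P x)%:C + exppoly lam Q x.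
    by rewrite rw_ansatzE (coef_familyK v_mult sQ).
  have a_solves : solves a.
    by move=> x /andP[xk x0]; rewrite aE -runtimeE ?runtime_le0.
  split=> // [b b_solves j u lj uv|x x0]; last first.
    by exists (runtime P x); [exact: expected_runtimeE|rewrite aE runtimeE//; lia].
  rewrite /a (_ : Q = coef_family lam v b) ?coef_coef_family//.
  apply: (stable_exppoly_inj hP lam_inj lam_roots sQ (stable_coef_family v_mult b)).
  move=> x xk; apply: (@addrI _ (rw_C P x)%:C).
  by rewrite -aE -rw_ansatzE -a_solves// -b_solves.
- by rewrite (expected_runtimeE hP) (runtime_rw_k0 hP lam_inj lam_roots).
Qed.
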